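(* The set consisting of the two clauses $$x\vee y\approx\top\Rightarrow x\approx\top,\ y\approx\top \qquad\text{and}\qquad x\approx\neg x\Rightarrow\emptyset$$ is a basis for the admissible clauses of De Morgan algebras.
   Context: A De Morgan algebra is an algebra $(A,\wedge,\vee,\neg,\bot,\top)$ such that $(A,\wedge,\vee,\bot,\top)$ is a bounded distributive lattice, $\neg\neg a=a$ and $\neg(a\wedge b)=\neg a\vee\neg b$ for all $a,b\in A$. A clause $\Sigma\Rightarrow\Delta$ (with $\Sigma,\Delta$ finite, possibly empty, sets of identities) is satisfied by an algebra if every assignment of the variables making all identities in $\Sigma$ true makes at least one identity in $\Delta$ true (so $\Sigma\Rightarrow\emptyset$ means that no assignment makes all of $\Sigma$ true). A universal class is the class of all algebras of the language satisfying some set of clauses; $\mathbb{U}(\mathcal{K})$ is the smallest universal class containing $\mathcal{K}$. For a quasivariety $\mathcal{Q}$, $\mathbf{F}_{\mathcal{Q}}$ is its free algebra on countably infinitely many generators. A set $\Lambda$ of clauses is a basis for the admissible clauses of $\mathcal{Q}$ if $\mathbb{U}(\mathbf{F}_{\mathcal{Q}})$ is axiomatized by $\Lambda$ relative to $\mathcal{Q}$, i.e. for every algebra $\mathbf{A}$: $\mathbf{A}\in\mathbb{U}(\mathbf{F}_{\mathcal{Q}})$ iff $\mathbf{A}\in\mathcal{Q}$ and $\mathbf{A}$ satisfies all clauses in $\Lambda$. *)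

(* Defs.v *)
From HB Require Import structures.
From mathcomp Require Import all_boot finmap.
From mathcomp Require Import boolp classical_sets.

Set Implicit Arguments.
Unset Strict Implicit.
Unset Printing Implicit Defensive.

Local Open Scope classical_set_scope.
Local Open Scope quotient_scope.

(* The algebras of the language (meet, join, neg, bot, top), subject to no
   equations. *)
Record algebra : Type := Algebra {
  carrier :> Type;
  meet : carrier -> carrier -> carrier;
  join : carrier -> carrier -> carrier;
  neg : carrier -> carrier;
  bot : carrier;
  top : carrier }.

Arguments bot {_}.
Arguments top {_}.

Record is_bounded_distributive_lattice (A : algebra) : Prop := {
  meetA : associative (@meet A);
  meetC : commutative (@meet A);
  joinA : associative (@join A);
  joinC : commutative (@join A);
  meet_joinK : forall a b : A, meet a (join a b) = a;
  join_meetK : forall a b : A, join a (meet a b) = a;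
  meet_joinDr : right_distributive (@meet A) (@join A);
  join_bot : right_id bot (@join A);
  meet_top : right_id top (@meet A) }.

Record is_De_Morgan (A : algebra) : Prop := {
  De_Morgan_lattice : is_bounded_distributive_lattice A;
  negK : forall a : A, neg (neg a) = a;
  neg_meet : forall a b : A, neg (meet a b) = join (neg a) (neg b) }.

(* Classes of algebras are predicates rather than terms of type
   (set algebra): the latter would put algebra strictly below the universe of
   eqType, so that the quotient types used below could not be carriers. *)
Definition algebra_class : Type := algebra -> Prop.

Definition De_Morgan : algebra_class := is_De_Morgan.

Inductive term : Type :=
| Var of nat
| Meet of term & term
| Join of term & term
| Neg of term
| Bot
| Top.

Fixpoint term_encode (t : term) : GenTree.tree nat :=
  match t with
  | Var n => GenTree.Leaf n
  | Meet s u => GenTree.Node 0 [:: term_encode s; term_encode u]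
  | Join s u => GenTree.Node 1 [:: term_encode s; term_encode u]
  | Neg s => GenTree.Node 2 [:: term_encode s]
  | Bot => GenTree.Node 3 [::]
  | Top => GenTree.Node 4 [::]
  end.

Fixpoint term_decode (t : GenTree.tree nat) : term :=
  match t with
  | GenTree.Leaf n => Var n
  | GenTree.Node 0 [:: s; u] => Meet (term_decode s) (term_decode u)
  | GenTree.Node 1 [:: s; u] => Join (term_decode s) (term_decode u)
  | GenTree.Node 2 [:: s] => Neg (term_decode s)
  | GenTree.Node 3 _ => Bot
  | _ => Top
  end.

Lemma term_encodeK : cancel term_encode term_decode.
Proof. by elim=> //= [s -> u ->|s -> u ->|s ->]. Qed.

HB.instance Definition _ := Countable.copy term (can_type term_encodeK).

Fixpoint eval (A : algebra) (v : nat -> A) (t : term) : A :=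
  match t with
  | Var n => v n
  | Meet s u => meet (eval v s) (eval v u)
  | Join s u => join (eval v s) (eval v u)
  | Neg s => neg (eval v s)
  | Bot => bot
  | Top => top
  end.

Definition identity : Type := (term * term)%type.

HB.instance Definition _ := Countable.on identity.

Definition holds (A : algebra) (v : nat -> A) (e : identity) : Prop :=
  eval v e.1 = eval v e.2.

Record clause : Type := Clause {
  premises : {fset identity};
  conclusions : {fset identity} }.

Definition satisfies (A : algebra) (c : clause) : Prop :=
  forall v : nat -> A,
    (forall e, e \in premises c -> holds v e) ->
    exists2 e, e \in conclusions c & holds v e.

Definition models (L : set clause) : algebra_class :=
  fun A => forall c, L c -> satisfies A c.

Definition is_universal_class (C : algebra_class) : Prop :=
  exists L : set clause, forall A, C A <-> models L A.

(* The smallest universal class containing K, as an intersection. *)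
Definition universal_class_of (K : algebra_class) : algebra_class :=
  fun A => forall C, is_universal_class C -> (forall B, K B -> C B) -> C A.

(* The free algebra of Q on the generators x_0, x_1, ... is the algebra of
   terms modulo the identities valid in Q. *)
Section FreeAlgebra.
Variable Q : algebra_class.

Definition valid_identity : rel term :=
  fun s t => `[< forall A, Q A -> forall v : nat -> A, holds v (s, t) >].

Lemma valid_identity_refl : reflexive valid_identity.
Proof. by move=> s; apply/asboolP. Qed.

Lemma valid_identity_sym : symmetric valid_identity.
Proof.
by move=> s t; apply/asboolP/asboolP => H A QA v; apply: esym; apply: H.
Qed.

Lemma valid_identity_trans : transitive valid_identity.
Proof.
move=> t s u /asboolP Hst /asboolP Htu; apply/asboolP => A QA v.
by apply: etrans (Hst A QA v) (Htu A QA v).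
Qed.

Canonical valid_identity_equiv :=
  EquivRel valid_identity
    valid_identity_refl valid_identity_sym valid_identity_trans.

Definition free_carrier : Type := {eq_quot valid_identity}.

Definition term_class (t : term) : free_carrier :=
  \pi_({eq_quot valid_identity}) t.

Definition class_repr (a : free_carrier) : term :=
  repr (a : {eq_quot valid_identity}).

Definition free_algebra : algebra := {|
  carrier := free_carrier;
  meet := fun a b => term_class (Meet (class_repr a) (class_repr b));
  join := fun a b => term_class (Join (class_repr a) (class_repr b));
  neg := fun a => term_class (Neg (class_repr a));
  bot := term_class Bot;
  top := term_class Top |}.

Lemma term_classP (s t : term) :
  term_class s = term_class t <->
  forall A, Q A -> forall v : nat -> A, eval v s = eval v t.
Proof.
split=> [/eqmodP/asboolP H|H]; first exact: H.
by apply/eqmodP/asboolP.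
Qed.

Lemma class_reprK (a : free_carrier) : term_class (class_repr a) = a.
Proof. exact: reprK. Qed.

Lemma eval_class_repr (t : term) (A : algebra) (v : nat -> A) :
  Q A -> eval v (class_repr (term_class t)) = eval v t.
Proof.
by move=> QA; apply: ((term_classP _ _).1 (class_reprK (term_class t)) A QA v).
Qed.

(* term_class is a homomorphism, i.e. the operations of free_algebra do not
   depend on the choice of representatives. *)
Lemma eval_term_class (t : term) :
  eval (A := free_algebra) (fun n => term_class (Var n)) t = term_class t.
Proof.
elim: t => //= [s -> u ->|s -> u ->|s ->]; apply/term_classP => A QA v /=;
  by rewrite !eval_class_repr.
Qed.

End FreeAlgebra.

Record is_hom (A B : algebra) (h : A -> B) : Prop := {
  hom_meet : forall a b, h (meet a b) = meet (h a) (h b);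
  hom_join : forall a b, h (join a b) = join (h a) (h b);
  hom_neg : forall a, h (neg a) = neg (h a);
  hom_bot : h bot = bot;
  hom_top : h top = top }.

Lemma free_algebra_universal (Q : algebra_class) (A : algebra) (v : nat -> A) :
  Q A ->
  exists! h : free_algebra Q -> A,
    is_hom h /\ forall n, h (term_class Q (Var n)) = v n.
Proof.
move=> QA; exists (fun a => eval v (class_repr a)); split.
  by do !split=> *; rewrite ?eval_class_repr.
move=> h [[hM hJ hN hB hT] hV]; apply/funext => a.
rewrite -{2}(class_reprK a); move: (class_repr a) => t.
rewrite -eval_term_class; elim: t => //= [s IHs u IHu|s IHs u IHu|s IHs].
- by rewrite hM -IHs -IHu.
- by rewrite hJ -IHs -IHu.
- by rewrite hN -IHs.
Qed.

Lemma free_algebra_De_Morgan : De_Morgan (free_algebra De_Morgan).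
Proof.
split; first split; repeat move=> ?;
  first [apply/term_classP | rewrite -[RHS]class_reprK; apply/term_classP];
  move=> A DA v /=; rewrite ?eval_class_repr //=;
  rewrite ?eval_class_repr //=; case: DA => -[] *; by auto.
Qed.

Definition admissible_basis (Q : algebra_class) (L : set clause) : Prop :=
  forall A : algebra,
    universal_class_of (fun B => B = free_algebra Q) A <-> Q A /\ models L A.

Definition top_join_prime : clause :=
  Clause [fset (Join (Var 0) (Var 1), Top)]%fset
         [fset (Var 0, Top); (Var 1, Top)]%fset.

Definition no_neg_fixpoint : clause :=
  Clause [fset (Var 0, Neg (Var 0))]%fset fset0.

(* Main.v *)
(* The homomorphisms from a De Morgan algebra A to the four-element algebra
   separate its points, and as a set with an order and an involution (swap)
   they are dual to A. Dually, embedding a finitely generated A into the free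
   algebra means covering Hom(A, four) by a power four^n, monotonically and
   equivariantly. If top is join-prime, Hom(A, four) has a least element h0,
   hence a greatest one; if negation has no fixpoint, it has a point hc fixed
   by swap. An assignment in four^n with fewer 1s in its first coordinates than
   in its second ones goes to h0, one with more 1s to swap h0; the balanced ones
   form an antichain, on which an equivariant map can be chosen freely, except
   that fixed points must go to fixed points such as hc. To refute one clause it
   is enough to reach finitely many given homomorphisms.
   Conversely, in the free algebra the least assignment (constantly
   (false, true)) shows that top is join-prime, and an assignment fixed by swap
   that negation has no fixpoint. *)

Require Import Defs.
From mathcomp Require Import all_boot finmap.
From mathcomp Require Import boolp classical_sets.

Set Implicit Arguments.
Unset Strict Implicit.
Unset Printing Implicit Defensive.

Local Open Scope classical_set_scope.

(** * Order, filters and prime separation in distributive lattices *)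

Section DistributiveLattice.
Variable A : algebra.
Hypothesis LA : is_bounded_distributive_lattice A.
Implicit Types (a b c : A) (P I F : set A).

Definition le a b : Prop := meet a b = a.

Lemma le_refl a : le a a.
Proof. by rewrite /le -{2}(join_meetK LA a a) (meet_joinK LA). Qed.

Lemma le_trans b a c : le a b -> le b c -> le a c.
Proof. by rewrite /le => ab bc; rewrite -ab -(meetA LA) bc. Qed.

Lemma le_antisym a b : le a b -> le b a -> a = b.
Proof. by rewrite /le => ab ba; rewrite -ab (meetC LA). Qed.

Lemma le_meetl a b : le (meet a b) a.
Proof. by rewrite /le (meetC LA) (meetA LA) le_refl. Qed.

Lemma le_meetr a b : le (meet a b) b.
Proof. by rewrite (meetC LA); apply: le_meetl. Qed.

Lemma le_meet a b c : le c a -> le c b -> le c (meet a b).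
Proof. by rewrite /le => ca cb; rewrite (meetA LA) ca cb. Qed.

Lemma le_joinl a b : le a (join a b).
Proof. exact: meet_joinK. Qed.

Lemma le_joinr a b : le b (join a b).
Proof. by rewrite (joinC LA); apply: le_joinl. Qed.

Lemma le_join a b c : le a c -> le b c -> le (join a b) c.
Proof.
rewrite /le => ac bc.
by rewrite (meetC LA) (meet_joinDr LA) !(meetC LA c) ac bc.
Qed.

Lemma le_top a : le a top.
Proof. exact: meet_top. Qed.

Lemma le_bot a : le bot a.
Proof. by rewrite -[a](join_bot LA); apply: le_joinr. Qed.

Record is_filter F : Prop := {
  filter_top : F top;
  filter_le : forall a b, le a b -> F a -> F b;
  filter_meet : forall a b, F a -> F b -> F (meet a b) }.

Record is_ideal I : Prop := {
  ideal_bot : I bot;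
  ideal_le : forall a b, le a b -> I b -> I a;
  ideal_join : forall a b, I a -> I b -> I (join a b) }.

Record is_prime_filter P : Prop := {
  prime_filter : is_filter P;
  prime_bot : ~ P bot;
  prime_join : forall a b, P (join a b) -> P a \/ P b }.

Lemma prime_filter_meet P a b :
  is_prime_filter P -> P (meet a b) <-> P a /\ P b.
Proof.
case=> -[_ Pup PM] _ _; split=> [Pab|[Pa Pb]]; last exact: PM.
by split; apply: Pup Pab; [apply: le_meetl | apply: le_meetr].
Qed.

Lemma prime_filter_join P a b :
  is_prime_filter P -> P (join a b) <-> P a \/ P b.
Proof.
case=> -[_ Pup _] _ PJ; split=> [/PJ //|[]]; apply: Pup.
  exact: le_joinl.
exact: le_joinr.
Qed.

Lemma filter_adjoin F a :
  is_filter F -> is_filter [set b | exists2 c, F c & le (meet c a) b].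
Proof.
move=> FF; split.
- by exists top; [apply: filter_top | apply: le_top].
- by move=> b c bc [d Fd dab]; exists d => //; apply: le_trans bc.
- move=> b c [d Fd db] [e Fe ec]; exists (meet d e); first exact: filter_meet.
  apply: le_meet; [apply: le_trans db|apply: le_trans ec]; apply: le_meet;
    try exact: le_meetr; apply: le_trans (le_meetl _ _) _.
    exact: le_meetl.
  exact: le_meetr.
Qed.

(** A filter maximal among those containing [F] and avoiding [I] is prime: if it contains neither
    [a] nor [b], it has members [c], [d] with [c /\ a] and [d /\ b] in [I], so by distributivity
    [c /\ d /\ (a \/ b)] is in [I]. *)
Lemma prime_filter_separation I F :
  is_ideal I -> is_filter F -> (forall a, F a -> ~ I a) ->
  exists2 P, is_prime_filter P & F `<=` P /\ forall a, P a -> ~ I a.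
Proof.
move=> II FF FI.
(* The union with F makes the empty chain harmless in Zorn's lemma. *)
pose good S := is_filter (S `|` F) /\ forall a, (S `|` F) a -> ~ I a.
have [C Cgood Ctot|M [[MF MI] Mmax]] := @Zorn_bigcup A good.
  set U := \bigcup_(X in C) X.
  have Usub S : C S -> S `|` F `<=` U `|` F.
    by move=> CS x [Sx|Fx]; [left; exists S | right].
  have common a b : (U `|` F) a -> (U `|` F) b ->
      exists S, [/\ S `<=` U `|` F, good S, (S `|` F) a & (S `|` F) b].
    have UF S : C S -> S `<=` U `|` F.
      by move=> CS x Sx; left; exists S.
    case=> [[S CS Sa]|Fa] [[S' CS' Sb]|Fb].
    - have [SS|SS] := Ctot _ _ CS CS'.
        by exists S'; split;
          [apply: UF | apply: Cgood | left; apply: SS | left].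
      by exists S; split; [apply: UF | apply: Cgood | left | left; apply: SS].
    - by exists S; split; [apply: UF | apply: Cgood | left | right].
    - by exists S'; split; [apply: UF | apply: Cgood | right | left].
    - exists F; split; [by move=> x; right| | by right | by right].
      by rewrite /good setUid.
  have sub S a : S `<=` U `|` F -> (S `|` F) a -> (U `|` F) a.
    by move=> SU [/SU //|]; right.
  split; first split.
  - by right; apply: filter_top.
  - move=> a b ab Ua; have [S [SU [SF _] Sa _]] := common a a Ua Ua.
    by apply: (sub S) => //; apply: filter_le ab Sa.
  - move=> a b Ua Ub; have [S [SU [SF _] Sa Sb]] := common a b Ua Ub.
    by apply: (sub S) => //; apply: filter_meet.
  - move=> a Ua; have [S [SU [_ SI] Sa _]] := common a a Ua Ua; exact: SI.
(* By maximality, adjoining [a] to the filter must produce an element of [I]. *)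
have meets a : ~ (M `|` F) a -> exists2 c, (M `|` F) c & I (meet c a).
  move=> Ma; apply: contrapT => noI.
  pose S := [set b | exists2 c, (M `|` F) c & le (meet c a) b].
  have MS : M `|` F `<=` S by move=> x Mx; exists x => //; apply: le_meetl.
  have Sa : S a by exists top; [apply: filter_top | apply: le_meetr].
  have SF : S `|` F = S.
    by apply/seteqP; split=> x; [case=> // Fx; apply: MS; right | left].
  apply: (Mmax S).
    split=> [|SM]; last by apply: Ma; left; apply: SM.
    by move=> x Mx; apply: MS; left.
  rewrite /good SF; split; first exact: filter_adjoin.
  by move=> b [c Mc cb] Ib; apply: noI; exists c => //; apply: ideal_le Ib.
exists (M `|` F); last by split=> // x; right.
split=> //; first by move/MI; apply; apply: ideal_bot.
move=> a b Mab; apply: contrapT => /not_orP[/meets[c Mc Ic] /meets[d Md Id]].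
apply: (MI (meet (meet c d) (join a b))).
  by do !apply: filter_meet.
rewrite (meet_joinDr LA); apply: ideal_join => //.
  apply: (ideal_le II _ Ic); apply: le_meet (le_meetr _ _).
  by apply: le_trans (le_meetl _ _) _; apply: le_meetl.
apply: (ideal_le II _ Id); apply: le_meet (le_meetr _ _).
by apply: le_trans (le_meetl _ _) _; apply: le_meetr.
Qed.

End DistributiveLattice.

(** * The four-element De Morgan algebra *)

Definition four : algebra :=
  {| carrier := (bool * bool)%type;
     meet := fun x y => (x.1 && y.1, x.2 && y.2);
     join := fun x y => (x.1 || y.1, x.2 || y.2);
     neg := fun x => (~~ x.2, ~~ x.1);
     bot := (false, false);
     top := (true, true) |}.

Lemma four_De_Morgan : De_Morgan four.
Proof.
by split; first split; do ![case=> [[] []] | move=> ?].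
Qed.

(** The automorphism exchanging the two fixpoints of negation. *)
Definition swap (x : four) : four := (x.2, x.1).

(* The order of the natural duality, for which swap is antitone and all
   operations of four are monotone; its least element is (false, true). *)
Definition dle (x y : four) : bool := (x.1 ==> y.1) && (y.2 ==> x.2).

Lemma swapK : involutive swap.
Proof. by case. Qed.

Lemma dle_refl x : dle x x.
Proof. by rewrite /dle !implybb. Qed.

Lemma dle_swap x y : dle (swap x) (swap y) = dle y x.
Proof. exact: andbC. Qed.

Lemma swap_hom : is_hom swap.
Proof. by split=> // [[[] []]]. Qed.

Lemma is_hom_comp (A B C : algebra) (h : A -> B) (k : B -> C) :
  is_hom h -> is_hom k -> is_hom (fun a => k (h a)).
Proof.
case=> hM hJ hN hB hT [kM kJ kN kB kT].
by split=> *; rewrite ?(hM, hJ, hN, hB, hT) ?(kM, kJ, kN, kB, kT).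
Qed.

Lemma eval_hom (A B : algebra) (h : A -> B) (v : nat -> A) t :
  is_hom h -> h (eval v t) = eval (fun n => h (v n)) t.
Proof.
by case=> hM hJ hN hB hT; elim: t => //= [s <- u <-|s <- u <-|s <-].
Qed.

Lemma eval_dle (z w : nat -> four) t :
  (forall n, dle (z n) (w n)) -> dle (eval z t) (eval w t).
Proof.
move=> zw; elim: t => //= [s|s|s];
  case: (eval z s) (eval w s) => [[] []] [[] []] //=;
  by move=> _ u; case: (eval z u) (eval w u) => [[] []] [[] []].
Qed.

(** * Homomorphisms from a De Morgan algebra to [four] *)

Section DeMorgan.
Variable A : algebra.
Hypothesis DA : is_De_Morgan A.
Let LA : is_bounded_distributive_lattice A := De_Morgan_lattice DA.
Implicit Types a b c d e : A.

Lemma neg_join a b : neg (join a b) = meet (neg a) (neg b).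
Proof. by rewrite -[RHS](negK DA) (neg_meet DA) !(negK DA). Qed.

Lemma neg_le a b : le a b -> le (neg b) (neg a).
Proof.
by move=> ab; rewrite -ab (neg_meet DA); apply: le_joinr.
Qed.

Lemma neg_bot : neg bot = top :> A.
Proof.
apply: (le_antisym LA); first exact: le_top.
by rewrite -[top](negK DA); apply/neg_le/le_bot.
Qed.

Lemma neg_top : neg top = bot :> A.
Proof. by rewrite -neg_bot (negK DA). Qed.

(** The second coordinate is membership in the partner of [P] under the involution of the dual
    space, the set of [a] with [neg a] outside [P]. *)
Definition prime_hom (P : set A) (a : A) : four :=
  (`[< P a >], ~~ `[< P (neg a) >]).

Lemma prime_homP P : is_prime_filter P -> is_hom (prime_hom P).
Proof.
move=> PP; have asM a b : `[< P (meet a b) >] = `[< P a >] && `[< P b >].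
  by rewrite -asbool_and; apply/asbool_equiv_eq/prime_filter_meet.
have asJ a b : `[< P (join a b) >] = `[< P a >] || `[< P b >].
  by rewrite -asbool_or; apply/asbool_equiv_eq/prime_filter_join.
have asT : `[< P top >] by apply/asboolP; exact: filter_top (prime_filter PP).
have asB : `[< P bot >] = false by apply/asboolPn; exact: prime_bot PP.
split=> [a b|a b|a||]; rewrite /prime_hom /=.
- by rewrite (neg_meet DA) asM asJ negb_or.
- by rewrite neg_join asM asJ negb_and.
- by rewrite (negK DA) negbK.
- by rewrite neg_bot asT asB.
- by rewrite neg_top asT asB.
Qed.

(** If [c] is not below [d], a prime filter containing [c] but not [d] gives a homomorphism with
    different first coordinates at [c] and [d]. *)
Lemma hom_separation a b :
  (forall h : A -> four, is_hom h -> h a = h b) -> a = b.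
Proof.
have half c d : (forall h : A -> four, is_hom h -> h c = h d) -> le c d.
  move=> hcd; apply: contrapT => cd.
  have [|||P PP [cP dP]] :=
    @prime_filter_separation A LA [set x | le x d] [set x | le c x].
  - split=> [|x y xy yd|x y xd yd]; [exact: le_bot|exact: le_trans yd|].
    exact: le_join.
  - split=> [|x y xy cx|x y cx cy]; [exact: le_top|exact: le_trans xy|].
    exact: le_meet.
  - by move=> x cx xd; apply: cd; apply: le_trans xd.
  have /(congr1 fst) /= := hcd _ (prime_homP PP).
  rewrite (_ : `[< P c >]); last by apply/asboolP/cP/le_refl.
  by move/esym/asboolP/dP; apply; apply: le_refl.
by move=> hab; apply: (le_antisym LA); apply: half => h hh; rewrite hab.
Qed.

(** Join-primeness makes [{top}] a prime filter; its homomorphism is least because all homomorphisms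
    preserve [top] and [neg]. *)
Lemma least_hom :
  (forall a b, join a b = top -> a = top \/ b = top) -> bot <> top :> A ->
  exists2 h0 : A -> four, is_hom h0 &
    forall (h : A -> four) a, is_hom h -> dle (h0 a) (h a).
Proof.
move=> topJ bt.
have P0 : is_prime_filter [set a : A | a = top].
  split=> //; split=> // [a b|a b] /=.
    by move=> ab atop; apply: (le_antisym LA); [apply: le_top|rewrite -atop].
  by move=> -> ->; apply: le_refl.
exists (prime_hom [set a | a = top]); first exact: prime_homP.
move=> h a hh; apply/andP; split; apply/implyP => /=.
  by move/asboolP => ->; rewrite hom_top.
by apply: contraL => /asboolP na; rewrite -(negK DA a) na (hom_neg hh) hom_top.
Qed.

(* I is the ideal generated by the elements below their own negation: when e
   and f witness a and b, e \/ (f /\ ~e) is a single witness for a \/ b. *)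
Lemma fixed_hom :
  (forall a, a <> neg a) ->
  exists2 h : A -> four, is_hom h & forall a, swap (h a) = h a.
Proof.
move=> nofix.
pose I := [set x : A | exists2 e, le e (neg e) & le (meet (neg e) x) e].
have neg_in d : le d (neg d) -> I d.
  by move=> dd; exists d => //; apply: le_meetr.
have II : is_ideal I.
  split.
  - by exists bot; [apply: le_bot | apply: le_meetr].
  - move=> a b ab [e ee eb]; exists e => //; apply: le_trans eb => //.
    apply: le_meet => //; first exact: le_meetl.
    by apply: le_trans ab => //; apply: le_meetr.
  - move=> a b [e ee ea] [f ff fb].
    have ne : neg (join e (meet f (neg e))) = meet (neg e) (join (neg f) e).
      by rewrite neg_join (neg_meet DA) (negK DA).
    exists (join e (meet f (neg e))); rewrite ne.
      apply: le_join => //; apply: le_meet => //.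
      + exact: le_joinr.
      + exact: le_meetr.
      + apply: le_trans (le_joinl LA _ _) => //.
        by apply: le_trans ff => //; apply: le_meetl.
    rewrite (meet_joinDr LA); apply: le_join => //.
      apply: le_trans (le_joinl LA _ _) => //; apply: le_trans ea => //.
      apply: le_meet (le_meetr _ _ _) => //.
      by apply: le_trans (le_meetl LA _ _) _ => //; apply: le_meetl.
    rewrite -(meetA LA) (meetC LA _ b) (meetA LA) (meet_joinDr LA).
    apply: le_join => //.
      apply: le_trans (le_joinr LA _ _) => //; apply: le_meet => //.
        apply: le_trans fb => //; apply: le_meet (le_meetr _ _ _) _ => //.
        by apply: le_trans (le_meetl LA _ _) _ => //; apply: le_meetr.
      by apply: le_trans (le_meetl LA _ _) _ => //; apply: le_meetl.
    by apply: le_trans (le_joinl LA _ _) => //; apply: le_meetr.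
have FF : is_filter [set x | I (neg x)].
  case: II => Ib Il Ij; split=> [|a b ab|a b] /=.
  - by rewrite neg_top.
  - by apply: Il; apply: neg_le.
  - by rewrite (neg_meet DA); apply: Ij.
have [|P PP [FP IP]] := prime_filter_separation LA II FF.
  (* For a common element [x], the join [l] of [neg x] and [x] has a witness [e]. Negating
     [neg e /\ l <= e] gives [neg e <= e \/ neg l]; since [neg l <= l], this yields [neg e <= e],
     and [e] is a fixpoint. *)
  move=> x Inx Ix; have [e ee ex] := ideal_join II Inx Ix.
  apply: (nofix e); apply: (le_antisym LA) => //.
  set l := join (neg x) x in ex.
  have nl : le (neg l) l.
    rewrite /l neg_join (negK DA).
    by apply: le_trans (le_meetl LA _ _) _ => //; apply: le_joinr.
  have nel : le (neg e) (join e (neg l)).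
    by rewrite -{2}(negK DA e) -(neg_meet DA); apply: neg_le.
  rewrite -nel (meet_joinDr LA); apply: le_join (le_meetr _ _ _) _ => //.
  apply: le_trans ex => //; apply: le_meet (le_meetl _ _ _) _ => //.
  by apply: le_trans nl => //; apply: le_meetr.
exists (prime_hom P); first exact: prime_homP.
move=> a; rewrite /swap /prime_hom /=.
(* [P] contains exactly one of [a] and [neg a]: their meet lies in [I], their join in the dual
   filter. *)
suff : `[< P a >] = ~~ `[< P (neg a) >] by move->.
apply/asboolP/negP => [Pa /asboolP Pna|/negP/asboolPn Pna].
  apply: (IP (meet a (neg a))); first by apply/prime_filter_meet.
  apply: neg_in; rewrite (neg_meet DA) (negK DA).
  by apply: le_trans (le_meetl LA _ _) _ => //; apply: le_joinr.
have /(prime_filter_join LA _ _ PP)[] // : P (join a (neg a)).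
apply: FP => /=; apply: neg_in.
rewrite neg_join (negK DA) (neg_meet DA) (negK DA).
by apply: le_trans (le_meetl LA _ _) _ => //; apply: le_joinr.
Qed.

End DeMorgan.

(** * Monotone equivariant maps are given by terms *)

Section Definability.
Variable I : finType.
Implicit Types y z : {ffun I -> four}.

Definition swap_ffun z : {ffun I -> four} := [ffun i => swap (z i)].

Definition dle_ffun y z : bool := [forall i, dle (y i) (z i)].

Definition env_ffun (z : nat -> four) : {ffun I -> four} :=
  [ffun i : I => z (choice.pickle i)].

Lemma env_ffun_surj y : exists z : nat -> four, env_ffun z = y.
Proof.
exists (fun n => if choice.unpickle n is Some i then y i else bot).
by apply/ffunP => i; rewrite ffunE choice.pickleK.
Qed.

(** In the first coordinate, the literal [x] tests that [x.1] is true and [Neg x] that [x.2] is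
    false. *)
Definition above_term y : term :=
  foldr (fun i => let x := Var (choice.pickle i) in
           Meet (Meet (if (y i).1 then x else Top)
                      (if (y i).2 then Top else Neg x)))
        Top (enum I).

Lemma above_termE (z : nat -> four) y :
  (eval z (above_term y)).1 = dle_ffun y (env_ffun z).
Proof.
transitivity (all (fun i => dle (y i) (z (choice.pickle i))) (enum I)).
  rewrite /above_term; elim: (enum I) => //= i s <-; rewrite /dle.
  congr (_ && _).
  by case: (y i) => [[] []] /=; case: (z (choice.pickle i)) => [[] []].
apply/allP/forallP => H i => [|_]; last by have := H i; rewrite ffunE.
by rewrite ffunE; apply: H; rewrite mem_enum.
Qed.

(* Disjunctive normal form: the first coordinate is obtained by monotonicity,
   and the second one from the first by equivariance. *)
Lemma definable (phi : {ffun I -> four} -> four) :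
  (forall y z, dle_ffun y z -> dle (phi y) (phi z)) ->
  (forall z, phi (swap_ffun z) = swap (phi z)) ->
  exists t, forall z : nat -> four, eval z t = phi (env_ffun z).
Proof.
move=> phi_mono phi_swap.
pose t := foldr (fun y => Join (above_term y)) Bot
            [seq y <- enum {: {ffun I -> four}} | (phi y).1].
have t1 (z : nat -> four) : (eval z t).1 = (phi (env_ffun z)).1.
  transitivity (has (fun y => dle_ffun y (env_ffun z))
                  [seq y <- enum {: {ffun I -> four}} | (phi y).1]).
    by rewrite /t; elim: [seq _ <- _ | _] => //= y s <-; rewrite above_termE.
  apply/hasP/idP => [[y]|phiz].
    rewrite mem_filter => /andP[phiy _] /phi_mono/andP[/implyP yz _].
    exact: yz.
  exists (env_ffun z); first by rewrite mem_filter phiz mem_enum.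
  by apply/forallP => i; apply: dle_refl.
exists t => z; rewrite [LHS]surjective_pairing [RHS]surjective_pairing t1.
have -> : (eval z t).2 = (swap (eval z t)).1 by [].
rewrite (eval_hom _ _ swap_hom) t1; congr (_, _).
rewrite (_ : env_ffun _ = swap_ffun (env_ffun z)) ?phi_swap //.
by apply/ffunP => i; rewrite !ffunE.
Qed.

End Definability.

(** * Covering finitely many homomorphisms by a power of [four] *)

Section Cover.
Variables (A : algebra) (T : finType) (h : T -> A -> four) (h0 hc : A -> four).
Hypothesis h_hom : forall j, is_hom (h j).
Hypothesis h0_hom : is_hom h0.
Hypothesis h0_least : forall (k : A -> four) a, is_hom k -> dle (h0 a) (k a).
Hypothesis hc_hom : is_hom hc.
Hypothesis hc_fixed : forall a, swap (hc a) = hc a.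

Let cube := {ffun option T -> four}.
Implicit Types y z : cube.

Definition weight1 z : nat := #|[pred i | (z i).1]|.
Definition weight2 z : nat := #|[pred i | (z i).2]|.

(** For balanced [z], the orientation of the picked coordinate decides between [h j] and its swap.
    If nothing is picked, balance makes the [None] coordinate symmetric too, so [z] is fixed by
    swap. *)
Definition cover z : A -> four :=
  if weight1 z < weight2 z then h0
  else if weight2 z < weight1 z then fun a => swap (h0 a)
  else if [pick j : T | (z (Some j)).1 != (z (Some j)).2] is Some j
  then if (z (Some j)).1 then h j else fun a => swap (h j a)
  else hc.

Lemma weight_swap z :
  (weight1 (swap_ffun z) = weight2 z) * (weight2 (swap_ffun z) = weight1 z).
Proof. by split; apply: eq_card => i; rewrite !inE ffunE. Qed.

Lemma dle_weight y z : dle_ffun y z ->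
  (weight1 y <= weight1 z) /\ (weight2 z <= weight2 y).
Proof.
move=> /forallP yz; split; apply/subset_leq_card/fintype.subsetP => i;
  rewrite !inE; by have /andP[/implyP + /implyP] := yz i.
Qed.

(** Going up, the set of true first coordinates grows and that of true second ones shrinks; balance
    forces equal cardinalities, hence equal sets. *)
Lemma dle_balanced y z : dle_ffun y z ->
  weight1 y = weight2 y -> weight1 z = weight2 z -> y = z.
Proof.
move=> yz wy wz; have [w1 w2] := dle_weight yz.
have e1 : weight1 y = weight1 z.
  by apply/eqP; rewrite eqn_leq w1 wz wy.
have e2 : weight2 z = weight2 y by rewrite -wy -wz.
apply/ffunP => i; move/forallP: yz => yz.
have sub1 : [pred i | (y i).1] \subset [pred i | (z i).1].
  by apply/fintype.subsetP => j; rewrite !inE; case/andP: (yz j) => /implyP.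
have sub2 : [pred i | (z i).2] \subset [pred i | (y i).2].
  by apply/fintype.subsetP => j; rewrite !inE; case/andP: (yz j) => _ /implyP.
have /(_ i) := subset_cardP e1 sub1; have /(_ i) := subset_cardP e2 sub2.
by rewrite !inE; case: (y i) (z i) => [? ?] [? ?] /= -> ->.
Qed.

Lemma cover_hom z : is_hom (cover z).
Proof.
have swapped k : is_hom k -> is_hom (fun a : A => swap (k a)).
  by move=> hk; apply: is_hom_comp hk swap_hom.
rewrite /cover; do 2?case: ifP => _ //; first exact: swapped.
by case: pickP => // j _; case: ifP => _ //; apply: swapped.
Qed.

Lemma cover_mono y z a : dle_ffun y z -> dle (cover y a) (cover z a).
Proof.
move=> yz; have [w1 w2] := dle_weight yz.
have greatest k : is_hom k -> dle (k a) (swap (h0 a)).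
  move=> hk; rewrite -(swapK (k a)) dle_swap.
  exact: h0_least (is_hom_comp hk swap_hom).
have [ylow|] := ltnP (weight1 y) (weight2 y).
  by rewrite {1}/cover ylow; apply: h0_least (cover_hom z).
have [zhigh _|] := ltnP (weight2 z) (weight1 z).
  by rewrite {2}/cover zhigh ltnNge (ltnW zhigh); apply: greatest (cover_hom y).
(* Both assignments are balanced, as the weights form a cycle of inequalities. *)
move=> wz wy; rewrite (dle_balanced yz) ?dle_refl //; apply/eqP;
  rewrite eqn_leq ?wz ?wy ?andbT.
  exact: leq_trans w1 (leq_trans wz w2).
exact: leq_trans w2 (leq_trans wy w1).
Qed.

Lemma cover_swap z a : cover (swap_ffun z) a = swap (cover z a).
Proof.
rewrite /cover !weight_swap; have [_|_|_] := ltngtP; rewrite ?swapK //.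
(* The picking condition is symmetric, so the same index is picked and only its orientation
   flips. *)
under eq_pick => j do rewrite !ffunE /= eq_sym.
case: pickP => [j|_]; last by rewrite hc_fixed.
by rewrite ffunE /=; case: (z (Some j)) => [[] []] //; rewrite swapK.
Qed.

Lemma cover_surj j : exists z, cover z = h j.
Proof.
(* [None] carries [(false, true)] to balance the [(true, false)] at [j]; all other entries are
   [(false, false)], so only [j] can be picked. *)
pose z : cube :=
  [ffun i => if i is Some k then (k == j, false) else (false, true)].
exists z.
have w1 : weight1 z = 1.
  rewrite -(card1 (Some j)); apply: eq_card => -[k|]; by rewrite !inE ffunE.
have w2 : weight2 z = 1.
  rewrite -(card1 (@None T)); apply: eq_card => -[k|]; by rewrite !inE ffunE.
rewrite /cover w1 w2 /=; case: pickP => [k|/(_ j)]; rewrite !ffunE /=.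
  by case: (k =P j) => // ->.
by rewrite eqxx.
Qed.

End Cover.

(** * Universal classes and clauses *)

Lemma universal_class_ofP (B A : algebra) :
  universal_class_of (fun C => C = B) A <->
  forall c, satisfies B c -> satisfies A c.
Proof.
split=> [UA c Bc|BA C [L CL] CB].
  apply: (UA (models (satisfies B))) Bc; first by exists (satisfies B).
  by move=> _ -> c'.
by apply/CL => c Lc; apply: BA; apply: (CL B).1 Lc; apply: CB.
Qed.

Lemma satisfies_identity (A : algebra) s t :
  satisfies A (Clause fset0 [fset (s, t)]%fset) <->
  forall v : nat -> A, eval v s = eval v t.
Proof.
split=> H v => [|_]; last by exists (s, t); [rewrite inE | apply: H].
by have [|e] := H v; [move=> e; rewrite inE | rewrite inE => /eqP ->].
Qed.

(** The axioms are identities, hence clauses without premises, and pass from [B] to [A]. *)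
Lemma De_Morgan_universal (A B : algebra) :
  De_Morgan B -> (forall c, satisfies B c -> satisfies A c) -> De_Morgan A.
Proof.
move=> DB BA.
(* Three variables suffice for every axiom; the remaining ones default to [a]. *)
have idA s t : (forall v : nat -> B, eval v s = eval v t) ->
    forall a b c : A, eval (nth a [:: a; b; c]) s = eval (nth a [:: a; b; c]) t.
  move=> H a b c; apply: (satisfies_identity A s t).1.
  exact/BA/satisfies_identity.
pose x := Var 0; pose y := Var 1; pose z := Var 2.
case: DB => -[mA mC jA jC mJK jMK mJ jb mt] nK nM.
split; first split.
- by apply: (idA (Meet x (Meet y z)) (Meet (Meet x y) z)) => v /=.
- by move=> a b; apply: (idA (Meet x y) (Meet y x) _ a b b) => v /=.
- by apply: (idA (Join x (Join y z)) (Join (Join x y) z)) => v /=.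
- by move=> a b; apply: (idA (Join x y) (Join y x) _ a b b) => v /=.
- by move=> a b; apply: (idA (Meet x (Join x y)) x _ a b b) => v /=.
- by move=> a b; apply: (idA (Join x (Meet x y)) x _ a b b) => v /=.
- by apply: (idA (Meet x (Join y z)) (Join (Meet x y) (Meet x z))) => v /=.
- by move=> a; apply: (idA (Join x Bot) x _ a a a) => v /=.
- by move=> a; apply: (idA (Meet x Top) x _ a a a) => v /=.
- by move=> a; apply: (idA (Neg (Neg x)) x _ a a a) => v /=.
- move=> a b.
  by apply: (idA (Neg (Meet x y)) (Join (Neg x) (Neg y)) _ a b b) => v /=.
Qed.

Lemma top_join_primeP (A : algebra) : satisfies A top_join_prime <->
  forall a b : A, join a b = top -> a = top \/ b = top.
Proof.
split=> [H a b ab|H v Hv].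
  have [|e] := H (nth a [:: a; b]); first by move=> e; rewrite inE => /eqP ->.
  by rewrite !inE => /orP[]/eqP ->; [left|right].
have /H[v0|v1] : join (v 0) (v 1) = top.
- by apply: (Hv (Join (Var 0) (Var 1), Top)); rewrite inE.
- by exists (Var 0, Top); rewrite // !inE eqxx.
- by exists (Var 1, Top); rewrite // !inE eqxx orbT.
Qed.

Lemma no_neg_fixpointP (A : algebra) : satisfies A no_neg_fixpoint <->
  forall a : A, a <> neg a.
Proof.
split=> [H a an|H v Hv].
  by have [|e] := H (fun=> a); [move=> e; rewrite inE => /eqP -> | rewrite inE].
by case: (H (v 0)); apply: (Hv (Var 0, Neg (Var 0))); rewrite inE.
Qed.

(** * The free De Morgan algebra and its clauses *)

Local Notation FDM := (free_algebra De_Morgan).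

Definition free_hom (z : nat -> four) (a : FDM) : four := eval z (class_repr a).

Lemma free_homP z : is_hom (free_hom z).
Proof.
by split=> *; rewrite /free_hom /= ?eval_class_repr //; apply: four_De_Morgan.
Qed.

Lemma free_hom_class z t : free_hom z (term_class De_Morgan t) = eval z t.
Proof. by rewrite /free_hom eval_class_repr //; apply: four_De_Morgan. Qed.

(** Homomorphisms to [four] separate points, so an identity true in [four] holds in every De Morgan
    algebra. *)
Lemma free_hom_inj (a b : FDM) :
  (forall z, free_hom z a = free_hom z b) -> a = b.
Proof.
move=> ab; rewrite -(class_reprK a) -(class_reprK b); apply/term_classP.
move=> A DA v; apply: (hom_separation DA) => h hh.
by rewrite !(eval_hom _ _ hh); apply: ab.
Qed.

Lemma free_top_join_prime (a b : FDM) : join a b = top -> a = top \/ b = top.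
Proof.
move=> ab; pose z0 : nat -> four := fun=> (false, true).
have top1 c : (free_hom z0 c).1 -> c = top.
  move=> c1; apply: free_hom_inj => z; rewrite (hom_top (free_homP z)).
  have above w : (free_hom w c).1.
    apply: (implyP (proj1 (andP (eval_dle _ _)))) c1 => n.
    by case: (w n) => [[] []].
  rewrite [LHS]surjective_pairing above.
  have -> // : (free_hom z c).2 = true.
  (* The second coordinate at [z] is the first one at the swapped assignment. *)
  have := above (fun n => swap (z n)).
  by rewrite /free_hom -(eval_hom _ _ swap_hom).
have := congr1 (fun c => (free_hom z0 c).1) ab.
rewrite (hom_join (free_homP z0)) (hom_top (free_homP z0)) /=.
by case/orP => /top1; [left | right].
Qed.

Lemma free_no_neg_fixpoint (a : FDM) : a <> neg a.
Proof.
pose z1 : nat -> four := fun=> (true, true).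
have fixed : swap (free_hom z1 a) = free_hom z1 a.
  by rewrite /free_hom (eval_hom _ _ swap_hom).
move=> /(congr1 (free_hom z1)); rewrite (hom_neg (free_homP z1)).
(* The elements fixed by [swap] are [bot] and [top], which negation exchanges. *)
by case: (free_hom z1 a) fixed => [[] []].
Qed.

(** A refutation [v] of a clause in [A] is pulled back along [cover] to a refutation [w] in the free
    algebra. *)
Lemma free_clauses (A : algebra) : De_Morgan A ->
  (forall a b : A, join a b = top -> a = top \/ b = top) ->
  (forall a : A, a <> neg a) ->
  forall c, satisfies FDM c -> satisfies A c.
Proof.
move=> DA topJ nofix c Fc v prem; apply: contrapT => noconcl.
have [|h0 h0_hom h0_least] := least_hom DA topJ.
  by move=> bt; apply: (nofix bot); rewrite (neg_bot DA).
have [hc hc_hom hc_fixed] := fixed_hom DA nofix.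
(* One homomorphism per conclusion, separating its two sides under [v]; these are the ones to be
   covered. *)
have sep (e : conclusions c) : exists h : A -> four,
    is_hom h /\ h (eval v (val e).1) <> h (eval v (val e).2).
  apply: contrapT => nosep; apply: noconcl; exists (val e); first exact: valP.
  apply: (hom_separation DA) => h hh; apply: contrapT => he.
  by apply: nosep; exists h.
have [h hP] := choice sep.
have h_hom e : is_hom (h e) by case: (hP e).
pose f := cover h h0 hc.
have f_hom y : is_hom (f y) by apply: cover_hom.
have defn n : exists t, forall z : nat -> four,
    eval z t = f (env_ffun _ z) (v n).
  apply: (definable (phi := fun z => f z (v n))) => [y z yz|z].
    exact: cover_mono.
  exact: cover_swap.
have [s sE] := choice defn.
pose w n : FDM := term_class De_Morgan (s n).
(* The value of [t] under [w] depends only on its value under [v], so the premises carry over. *)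
have wE z t : free_hom z (eval w t) = f (env_ffun _ z) (eval v t).
  rewrite (eval_hom _ _ (free_homP z)) (eval_hom _ _ (f_hom _)).
  by congr eval; apply/funext => n; rewrite free_hom_class sE.
have [e /prem ve|e ec we] := Fc w.
  by apply: free_hom_inj => z; rewrite !wE ve.
have [y yE] : exists y, f y = h [` ec]%fset by apply: cover_surj.
have [z zE] := env_ffun_surj y.
case: (hP [` ec]%fset) => _; apply.
by rewrite -yE -zE -!wE /= we.
Qed.

Theorem theorem23 :
  admissible_basis De_Morgan [set top_join_prime; no_neg_fixpoint].
Proof.
move=> A; rewrite universal_class_ofP; split=> [FA|[DA mA]].
  split; first exact: De_Morgan_universal free_algebra_De_Morgan FA.
  move=> c [->|->]; apply: FA.
    exact/top_join_primeP/free_top_join_prime.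
  exact/no_neg_fixpointP/free_no_neg_fixpoint.
apply: free_clauses => //.
  by apply/top_join_primeP/mA; left.
by apply/no_neg_fixpointP/mA; right.
Qed.
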